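(* Let $\mu$ be a finite positive Borel measure on $(0,1)$ and let $\Gamma_\mu$ be the operator given by the infinite matrix with entries $\gamma_{n,k}=\binom{n+k}{k}\int_0^1 t^k(1-t)^n\,d\mu(t)$, $n,k\ge 0$. Then $\Gamma_\mu$ is a Hankel operator if and only if $\mu$ is a constant multiple of the Lebesgue measure on $(0,1)$.
   Context: An operator given by an infinite matrix $(\gamma_{n,k})_{n,k\ge 0}$ (acting on power series $f(z)=\sum_{k} a_k z^k$ by $f\mapsto \sum_{n}\left(\sum_{k}\gamma_{n,k}a_k\right)z^n$) is called a Hankel operator if its matrix is a Hankel matrix, i.e. $\gamma_{n,k}$ depends only on $n+k$. Constant multiples include the multiple by $0$ (the zero measure). *)

(* Defs.v *)
From mathcomp Require Import all_boot all_order all_algebra.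
From mathcomp Require Import all_classical all_reals all_analysis.
From mathcomp Require Import complex.

Set Implicit Arguments.
Unset Strict Implicit.
Unset Printing Implicit Defensive.

Import Order.TTheory GRing.Theory Num.Theory.
Import numFieldNormedType.Exports.

Local Open Scope classical_set_scope.
Local Open Scope ring_scope.

(* A power series over K is given by its sequence of coefficients nat -> K. *)

(* The operator is partial: it is represented by its graph, so that a is in
   the domain iff all the series \sum_k g n k * a k converge. *)
Definition matrix_operator (K : numFieldType) (g : nat -> nat -> K)
    (a b : nat -> K) : Prop :=
  forall n, series (fun k => g n k * a k) @ \oo --> b n.

Definition is_hankel_matrix (T : Type) (g : nat -> nat -> T) : Prop :=
  forall n k n' k' : nat, (n + k = n' + k')%N -> g n k = g n' k'.

(* By matrix_operator_inj below, the matrix g is unique. *)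
Definition is_hankel_operator (K : numFieldType)
    (T : (nat -> K) -> (nat -> K) -> Prop) : Prop :=
  exists2 g : nat -> nat -> K, T = matrix_operator g & is_hankel_matrix g.

Lemma matrix_operator_monomial (K : numFieldType) (g : nat -> nat -> K)
    (k : nat) : matrix_operator g (fun j => (j == k)%:R) (fun n => g n k).
Proof.
move=> n; apply: cvg_near_cst; near=> m.
have km : (k < m)%N by near: m; exact: nbhs_infty_gt.
rewrite /series /= big_mkord (bigD1 (Ordinal km)) //= eqxx mulr1 big1 ?addr0//.
by move=> i /negbTE ik; rewrite -val_eqE /= in ik; rewrite ik mulr0.
Unshelve. all: by end_near. Qed.

Lemma matrix_operator_inj (K : numFieldType) (g h : nat -> nat -> K) :
  matrix_operator g = matrix_operator h -> forall n k, g n k = h n k.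
Proof.
move=> gh n k.
have := @matrix_operator_monomial _ g k; rewrite gh => /(_ n) g_cvg.
have h_cvg := @matrix_operator_monomial _ h k n.
exact: cvg_unique g_cvg h_cvg.
Qed.

Definition gamma_entry (R : realType)
    (mu : {measure set (measurableTypeR R) -> \bar R}) (n k : nat) : R :=
  'C(n + k, k)%:R * \int[mu]_(t in `]0, 1[) (t ^+ k * (1 - t) ^+ n).

(* Acts on power series with complex coefficients. *)
Definition Gamma_op (R : realType)
    (mu : {measure set (measurableTypeR R) -> \bar R}) :
    (nat -> (R[i] : numFieldType)) -> (nat -> (R[i] : numFieldType)) -> Prop :=
  matrix_operator (fun n k => ((gamma_entry mu n k)%:C)%C).

(* Main.v *)
Require Import Defs.
From mathcomp Require Import all_boot all_order all_algebra.
From mathcomp Require Import all_classical all_reals all_analysis.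
From mathcomp Require Import measurable_realfun complex ring lra.

Import Order.TTheory GRing.Theory Num.Theory.
Import numFieldNormedType.Exports.

Local Open Scope classical_set_scope.
Local Open Scope ring_scope.

(** The matrix of an operator can be read off from its values on monomials, so
    the question is when the entries gamma(n,k) depend on n + k only.

    For c times the Lebesgue measure, the Beta integral gives
    gamma(n,k) = c / (n + k + 1) (gamma_entry_scale), a Hankel matrix.

    Conversely, expanding 1 = ((1 - t) + t)^N shows that the entries on each
    antidiagonal n + k = N add up to the total mass c of mu, whatever mu is
    (sum_gamma_entry). If the matrix is Hankel, these N + 1 entries are all
    equal to gamma(0,N), which is the N-th moment of mu. Hence this moment is
    c / (N + 1), the N-th moment of c times the Lebesgue measure
    (moment_hankel).

    It remains to see that a finite measure on (0,1) is determined by its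
    moments (moments_determine_measure). Two measures with the same moments
    integrate every polynomial to the same value, so it is enough to
    approximate the indicator of (-oo,x) by polynomials, boundedly and pointwise
    on (0,1). The polynomials (1 - X^N)^M do this when N tends to infinity and
    M grows slightly faster than x^-N: then M t^N tends to 0 for t < x and to
    infinity for t >= x, and by Bernoulli's inequality
    1 - M t^N <= (1 - t^N)^M <= 1 / (1 + M t^N)
    (cvg_step_poly). Dominated convergence then gives the equality of the two
    measures on rays, which generate the Borel sets. *)

(** * Polynomials converging to the indicator of a ray *)

Lemma bernoulli_ineq {R : realFieldType} (u : R) (n : nat) :
  -1 <= u -> 1 + n%:R * u <= (1 + u) ^+ n.
Proof.
move=> u1; elim: n => [|n IHn]; first by rewrite mul0r addr0 expr0.
have u0 : 0 <= 1 + u by lra.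
rewrite exprS; apply: le_trans (ler_wpM2l u0 IHn).
have : 0 <= n%:R * (u * u) by rewrite mulr_ge0// -expr2 sqr_ge0.
rewrite -natr1; lra.
Qed.

Section step_polynomials.
Context {R : realType}.
Implicit Types (x t : R) (n : nat).

(** The multiplicity exceeds x^-N by the factor n + 1, because a bounded factor
    would give the wrong limit at t = x. With the square (n + 1)^2 as degree N,
    Bernoulli's inequality alone shows that (n + 1) (t / x)^N still tends to 0
    for t < x. *)
Definition step_deg n : nat := (n.+1 ^ 2)%N.
Definition step_mult x n : nat := (Num.truncn (n.+1%:R / x ^+ step_deg n)).+1.
Definition step_poly x n : {poly R} := (1 - 'X^(step_deg n)) ^+ step_mult x n.

Lemma horner_step_poly x n t :
  (step_poly x n).[t] = (1 - t ^+ step_deg n) ^+ step_mult x n.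
Proof. by rewrite /step_poly !hornerE. Qed.

Lemma step_poly_itv x n t : 0 < t < 1 -> 0 <= (step_poly x n).[t] <= 1.
Proof.
move=> /andP[/ltW t0 /ltW t1]; rewrite horner_step_poly.
have a0 : 0 <= t ^+ step_deg n by rewrite exprn_ge0.
have a1 : t ^+ step_deg n <= 1 by rewrite exprn_ile1.
by rewrite exprn_ge0 ?exprn_ile1//; lra.
Qed.

Lemma step_mult_bounds x n : 0 < x ->
  n.+1%:R / x ^+ step_deg n <= (step_mult x n)%:R
    <= n.+1%:R / x ^+ step_deg n + 1.
Proof.
move=> x0; have q0 : 0 <= n.+1%:R / x ^+ step_deg n.
  by rewrite divr_ge0// exprn_ge0// ltW.
have /andP[h1 h2] := truncn_itv q0.
by rewrite /step_mult (ltW h2) -natr1 lerD2r.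
Qed.

(** Here M t^N >= (n + 1) (t / x)^N >= n + 1, and (1 - a)^M is at most
    1 / (1 + a)^M <= 1 / (1 + M a) because (1 - a) (1 + a) <= 1. *)
Lemma step_poly_small x n t : 0 < x -> x <= t -> t < 1 ->
  (step_poly x n).[t] <= n.+1%:R^-1.
Proof.
move=> x0 xt t1; rewrite horner_step_poly.
set N := step_deg n; set M := step_mult x n.
have /andP[Mge _] := step_mult_bounds x n x0; rewrite -/N -/M in Mge.
have t0 : 0 < t by exact: lt_le_trans xt.
have a0 : 0 < t ^+ N by rewrite exprn_gt0.
have a1 : t ^+ N <= 1 by rewrite exprn_ile1// ltW.
have xN0 : 0 < x ^+ N by rewrite exprn_gt0.
have Mt : n.+1%:R <= M%:R * t ^+ N.
  apply: le_trans (ler_wpM2r (ltW a0) Mge).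
  rewrite -mulrA ler_peMr// mulrC ler_pdivlMr// mul1r.
  by rewrite lerXn2r// nnegrE ltW.
have b : 1 + M%:R * t ^+ N <= (1 + t ^+ N) ^+ M by apply: bernoulli_ineq; lra.
have p1 : (1 - t ^+ N) ^+ M * (1 + t ^+ N) ^+ M <= 1.
  rewrite -exprMn exprn_ile1//.
    by rewrite mulr_ge0//; lra.
  by have := sqr_ge0 (t ^+ N); nra.
have p0 : 0 <= (1 - t ^+ N) ^+ M by rewrite exprn_ge0//; lra.
rewrite -[leRHS]mul1r ler_pdivlMr//; apply: le_trans p1.
by rewrite ler_wpM2l//; lra.
Qed.

(** With h = x / t - 1, Bernoulli's inequality applied to (x / t)^N bounds the
    main part (n + 1) (t / x)^N of M t^N by 1 / (h (n + 1)), since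
    N = (n + 1)^2. Rounding M up adds at most t^N, which obeys the same bound;
    hence the constant 2 / h. *)
Lemma step_poly_large x n t : 0 < t -> t < x -> x < 1 ->
  1 - 2 / (x / t - 1) * n.+1%:R^-1 <= (step_poly x n).[t].
Proof.
move=> t0 tx x1; rewrite horner_step_poly.
set N := step_deg n; set M := step_mult x n.
have x0 : 0 < x by exact: lt_trans tx.
have /andP[_ Mle] := step_mult_bounds x n x0; rewrite -/N -/M in Mle.
have a0 : 0 < t ^+ N by rewrite exprn_gt0.
have a1 : t ^+ N <= 1 by rewrite exprn_ile1// ltW// (lt_trans tx).
have xN0 : 0 < x ^+ N by rewrite exprn_gt0.
have xN1 : x ^+ N <= 1 by rewrite exprn_ile1// ltW.
have h0 : 0 < x / t - 1 by rewrite subr_gt0 ltr_pdivlMr// mul1r.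
set h := x / t - 1 in h0 *.
have n0 : (0 : R) < n.+1%:R by [].
have qh : n.+1%:R ^+ 2 * h <= x ^+ N / t ^+ N.
  rewrite -natrX -/(step_deg n) -/N -expr_div_n.
  have -> : x / t = 1 + h by rewrite /h addrC subrK.
  have B : 1 + N%:R * h <= (1 + h) ^+ N.
    by apply: bernoulli_ineq; apply: le_trans (ltW h0); rewrite lerN10.
  by apply: le_trans B; rewrite lerDr.
have key : n.+1%:R / x ^+ N * t ^+ N <= h^-1 * n.+1%:R^-1.
  rewrite -invfM -[leRHS]mul1r ler_pdivlMr ?mulr_gt0//.
  have -> : n.+1%:R / x ^+ N * t ^+ N * (h * n.+1%:R) =
     (n.+1%:R ^+ 2 * h) / (x ^+ N / t ^+ N).
    by field; rewrite !gt_eqF.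
  by rewrite ler_pdivrMr ?divr_gt0// mul1r.
have key2 : t ^+ N <= n.+1%:R / x ^+ N * t ^+ N.
  rewrite ler_peMl ?(ltW a0)// ler_pdivlMr// mul1r.
  by apply: le_trans xN1 _; rewrite ler1n.
have b : 1 + M%:R * (- t ^+ N) <= (1 - t ^+ N) ^+ M.
  by apply: bernoulli_ineq; lra.
apply: le_trans b; have := ler_wpM2r (ltW a0) Mle.
rewrite mulrDl mul1r mulrN -mulrA.
move: key key2; move: (_ / _ * _) (_^-1 * _) (M%:R * _) => u v w; lra.
Qed.

Lemma cvg_step_poly x t : 0 < x < 1 -> 0 < t < 1 ->
  (step_poly x n).[t] @[n --> \oo] --> (\1_(`]-oo, x[) t : R).
Proof.
move=> /andP[x0 x1] /andP[t0 t1].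
have h k : k * n.+1%:R^-1 @[n --> \oo] --> (0 : R).
  rewrite -[0 in X in _ --> X](mulr0 k).
  by apply: cvgM; [exact: cvg_cst|exact: cvg_harmonic].
have i01 n := @step_poly_itv x n t; rewrite t0 t1 in i01.
rewrite indicE; have [tx|xt] := ltP t x.
- rewrite mem_set/= ?in_itv//=.
  apply: (@squeeze_cvgr _ _ _ _
    (fun n => 1 - 2 / (x / t - 1) * n.+1%:R^-1) (cst 1)).
  + apply: nearW => n; apply/andP; split; first exact: step_poly_large.
    by have /andP[] := i01 n isT.
  + rewrite -[X in _ --> X]subr0; apply: cvgB; [exact: cvg_cst|exact: h].
  + exact: cvg_cst.
- rewrite memNset/= ?in_itv//=; last by apply/negP; rewrite -leNgt.
  apply: (@squeeze_cvgr _ _ _ _ (cst 0) (fun n => n.+1%:R^-1)).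
  + apply: nearW => n; apply/andP; split; last exact: step_poly_small.
    by have /andP[] := i01 n isT.
  + exact: cvg_cst.
  + exact: cvg_harmonic.
Qed.
End step_polynomials.

(** * Integrals of polynomials and the entries of the matrix *)

Section poly_integral.
Context {R : realType} (mu : {measure set (measurableTypeR R) -> \bar R}).
Hypothesis mu_fin : (mu `]0%R, 1%R[%classic < +oo)%E.
Implicit Types p q : {poly R}.

Definition poly_integral p : R := \int[mu]_(t in `]0, 1[) p.[t].

Lemma measurable_horner p (D : set (measurableTypeR R)) :
  measurable_fun D (fun t => p.[t]).
Proof.
apply: measurable_funTS; apply: continuous_measurable_fun.
exact: continuous_horner.
Qed.

Lemma integrable_horner p :
  mu.-integrable `]0, 1[ (EFin \o (fun t => p.[t])).
Proof.
apply: measurable_bounded_integrable => //; first exact: measurable_horner.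
exists (\sum_(i < size p) `|p`_i|); split; first exact: num_real.
move=> M ltM t /=; rewrite in_itv/= => /andP[t0 t1].
apply: le_trans (ltW ltM); rewrite horner_coef.
apply: le_trans (ler_norm_sum _ _ _) _; apply: ler_sum => i _.
by rewrite normrM ler_piMr// normrX exprn_ile1// ger0_norm// ltW.
Qed.

Lemma poly_integralD p q :
  poly_integral (p + q) = poly_integral p + poly_integral q.
Proof.
rewrite /poly_integral -RintegralD//; try exact: integrable_horner.
by apply: eq_Rintegral => t _; rewrite hornerD.
Qed.

Lemma poly_integralZ a p : poly_integral (a *: p) = a * poly_integral p.
Proof.
rewrite /poly_integral -RintegralZl//; last exact: integrable_horner.
by apply: eq_Rintegral => t _; rewrite hornerZ.
Qed.

Lemma poly_integral_sum (n : nat) (F : nat -> {poly R}) :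
  poly_integral (\sum_(i < n) F i) = \sum_(i < n) poly_integral (F i).
Proof.
elim: n => [|n IHn]; last by rewrite !big_ord_recr /= poly_integralD IHn.
by rewrite !big_ord0 -(scale0r 1) poly_integralZ mul0r.
Qed.

Lemma poly_integral_coef p :
  poly_integral p = \sum_(i < size p) p`_i * poly_integral 'X^i.
Proof.
rewrite -{1}[p]coefK poly_def.
rewrite (poly_integral_sum (size p) (fun i => p`_i *: 'X^i)).
by apply: eq_bigr => i _; rewrite poly_integralZ.
Qed.

Lemma poly_integral1 : poly_integral 1 = fine (mu `]0%R, 1%R[%classic).
Proof.
rewrite /poly_integral -[RHS]mul1r -Rintegral_cst//.
by apply: eq_Rintegral => t _; rewrite hornerC.
Qed.

Lemma gamma_entryE n k :
  gamma_entry mu n k = 'C(n + k, k)%:R * poly_integral ('X^k * (1 - 'X) ^+ n).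
Proof. by congr (_ * _); apply: eq_Rintegral => t _; rewrite !hornerE. Qed.

Lemma gamma_entry_moment n : gamma_entry mu 0 n = poly_integral 'X^n.
Proof. by rewrite gamma_entryE add0n binn mul1r expr0 mulr1. Qed.

(** Entries on an antidiagonal are the integrals of the Bernstein polynomials of
    one degree, which form a partition of unity. *)
Lemma sum_gamma_entry n :
  \sum_(k < n.+1) gamma_entry mu (n - k) k = fine (mu `]0%R, 1%R[%classic).
Proof.
rewrite -poly_integral1 -[in RHS](expr1n _ n) -[in RHS](subrK 'X 1).
rewrite exprDn (poly_integral_sum n.+1
  (fun k => ((1 - 'X) ^+ (n - k) * 'X^k) *+ 'C(n, k))).
apply: eq_bigr => k _; have kn : (k <= n)%N by rewrite -ltnS.
rewrite gamma_entryE subnK// -poly_integralZ scaler_nat.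
by rewrite [_ * 'X^k]mulrC.
Qed.

(** The antidiagonal through (0, n) has n + 1 entries, all equal to the n-th
    moment. *)
Lemma moment_hankel n : is_hankel_matrix (gamma_entry mu) ->
  poly_integral 'X^n = fine (mu `]0%R, 1%R[%classic) / n.+1%:R.
Proof.
move=> hank; rewrite -(sum_gamma_entry n) -gamma_entry_moment.
rewrite (eq_bigr (fun=> gamma_entry mu 0 n)) => [|k _].
  by rewrite sumr_const card_ord -[_ *+ _]mulr_natr mulfK.
have kn : (k <= n)%N by rewrite -ltnS.
by apply: hank; rewrite subnK.
Qed.

Lemma cvg_poly_integral_step (x : R) : 0 < x < 1 ->
  (poly_integral (step_poly x n))%:E @[n --> \oo]
    --> mu (`]-oo, x[ `&` `]0, 1[).
Proof.
move=> x01.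
have mI : measurable_fun (`]0%R, 1%R[%classic : set (measurableTypeR R))
    (EFin \o (\1_(`]-oo, x[) : R -> R)).
  by apply/measurable_EFinP; exact: measurable_indic.
have [//|||||_ _] := @dominated_convergence _ (measurableTypeR R) R mu
  `]0, 1[ _ (fun n t => ((step_poly x n).[t])%:E) (fun t => (\1_(`]-oo, x[) t)%:E)
  (cst 1%E) _ mI.
- by move=> n; apply/measurable_EFinP; exact: measurable_horner.
- apply: aeW => t /=; rewrite in_itv/= => t01.
  by apply: cvg_EFin; [exact: nearW|exact: cvg_step_poly].
- have := integrable_horner 1; apply: eq_integrable => // t _ /=.
  by rewrite hornerC.
- apply: aeW => t n /=; rewrite in_itv/= => t01.
  by have /andP[p0 p1] := step_poly_itv x n t t01; rewrite lee_fin ger0_norm.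
rewrite integral_indic//; apply: cvg_trans; apply: near_eq_cvg.
apply: nearW => n; rewrite /poly_integral /Rintegral fineK//.
by apply: integrable_fin_num => //; exact: integrable_horner.
Qed.

End poly_integral.

(** * The moment problem on the open unit interval *)

(** The rays (-oo,x) are stable under intersection and generate the Borel sets.
    Only 0 < x < 1 needs the step polynomials: the trace of a ray on (0,1) is
    otherwise empty or everything, and the total mass is the zeroth moment. *)
Lemma moments_determine_measure {R : realType}
    (mu nu : {measure set (measurableTypeR R) -> \bar R}) :
  (mu `]0%R, 1%R[%classic < +oo)%E -> (nu `]0%R, 1%R[%classic < +oo)%E ->
  (forall n, poly_integral mu 'X^n = poly_integral nu 'X^n) ->
  forall A : set (measurableTypeR R), measurable A -> A `<=` `]0, 1[ ->
    mu A = nu A.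
Proof.
move=> muoo nuoo mom A mA A01.
have pol p : poly_integral mu p = poly_integral nu p.
  rewrite !poly_integral_coef//.
  by apply: eq_bigr => i _; rewrite mom.
have m01 : measurable (`]0%R, 1%R[%classic : set (measurableTypeR R)) by [].
have full : mu `]0%R, 1%R[%classic = nu `]0%R, 1%R[%classic.
  rewrite -[LHS]fineK ?ge0_fin_numE// -[RHS]fineK ?ge0_fin_numE//.
  by rewrite -!poly_integral1 pol.
pose mu' : {measure set (measurableTypeR R) -> \bar R} := mrestr mu m01.
pose nu' : {measure set (measurableTypeR R) -> \bar R} := mrestr nu m01.
suff : mu' A = nu' A by rewrite /= /mrestr setIidl.
refine (@measure_unique _ R (measurableTypeR R) (@RGenInftyO.G R)
  (fun n => `]-oo, n%:R[%classic) _ _ _ _ mu' nu' _ _ A mA) => //.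
- exact: RGenInftyO.measurableE.
- move=> _ _ [x ->] [y ->]; exists (Num.min x y).
  by apply/seteqP; split => z /=; rewrite !in_itv/= lt_min => /andP.
- by move=> n; exists n%:R.
- apply/seteqP; split => // z _; exists (Num.truncn `|z|).+1 => //=.
  by rewrite in_itv/=; apply: le_lt_trans (ler_norm z) (truncnS_gt _).
- move=> _ [x ->]; rewrite /= /mrestr.
  have [x0|x0] := leP x 0.
    rewrite (_ : _ `&` _ = set0) ?measure0//; apply/seteqP; split => // z /=.
    rewrite !in_itv/= => -[zx /andP[z0 _]].
    by have := lt_trans z0 (lt_le_trans zx x0); rewrite ltxx.
  have [x1|x1] := leP 1 x.
    rewrite setIidr// => z /=; rewrite !in_itv/= => /andP[_ z1].
    exact: lt_le_trans x1.
  have x01 : 0 < x < 1 by rewrite x0.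
  have := cvg_poly_integral_step nu nuoo x x01.
  under eq_fun do rewrite -pol.
  exact/cvg_unique/cvg_poly_integral_step.
- move=> n; apply: le_lt_trans muoo; apply: le_measure; rewrite ?inE//.
  exact: measurableI.
Qed.

(** * Multiples of the Lebesgue measure *)

(** The Beta integral k! n! / (n + k + 1)! cancels the binomial coefficient up to
    the factor n + k + 1. *)
Lemma gamma_entry_lebesgue {R : realType} n k :
  gamma_entry (@lebesgue_measure R) n k = (n + k).+1%:R^-1.
Proof.
rewrite /gamma_entry.
have -> : \int[@lebesgue_measure R]_(t in `]0, 1[) (t ^+ k * (1 - t) ^+ n) =
    beta_fun k.+1 n.+1.
  rewrite /beta_fun -Rintegral_mkcond -Rintegral_itv_obnd_cbnd.
    rewrite -Rintegral_itv_bndo_bndc//.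
    by apply: integrableS (integrable_XMonemX k n) => //; exact: subset_itvW.
  by apply: integrableS (integrable_XMonemX k n) => //; exact: subset_itv_oc_cc.
rewrite beta_fun_fact (addnC k n) factS [X in _ / X%:R]mulnC.
rewrite [X in _ / X]natrM invfM !mulrA.
rewrite -natrM -(@bin_fact (n + k) k) ?leq_addl// addnK.
by rewrite divff ?mul1r// pnatr_eq0 -lt0n !muln_gt0 bin_gt0 leq_addl !fact_gt0.
Qed.

(** The constant is nonnegative because it is the mass of (0,1), so that mu agrees
    on (0,1) with a measure obtained from the Lebesgue measure by scaling. *)
Lemma gamma_entry_scale {R : realType} (c : R)
    (mu : {measure set (measurableTypeR R) -> \bar R}) :
  (forall A : set (measurableTypeR R), measurable A -> A `<=` `]0, 1[ ->
     mu A = (c%:E * @lebesgue_measure R A)%E) ->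
  forall n k, gamma_entry mu n k = c / (n + k).+1%:R.
Proof.
move=> muE n k.
have leb01 : @lebesgue_measure R `]0%R, 1%R[%classic = 1%E.
  by rewrite lebesgue_measure_itv/= lte01 EFinN sube0.
have c0 : 0 <= c by rewrite -lee_fin -[leRHS]mule1 -leb01 -muE.
have leb_fin : (@lebesgue_measure R `]0%R, 1%R[%classic < +oo)%E.
  by rewrite leb01 ltry.
rewrite -gamma_entry_lebesgue !gamma_entryE mulrCA; congr (_ * _).
set p := _ * _; rewrite /poly_integral /Rintegral.
rewrite (eq_measure_integral (mscale (NngNum c0) lebesgue_measure)); last first.
  by move=> A mA A01; rewrite muE.
rewrite ge0_integral_mscale//=.
- rewrite fineM//; apply: integrable_fin_num => //; exact: integrable_horner.
- by apply/measurable_EFinP; exact: measurable_horner.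
- move=> t; rewrite in_itv/= => /andP[t0 t1].
  by rewrite lee_fin !hornerE mulr_ge0// exprn_ge0 ?subr_ge0// ltW.
Qed.

(** * The characterization *)

Lemma Gamma_hankelP {R : realType}
    (mu : {measure set (measurableTypeR R) -> \bar R}) :
  is_hankel_operator (Gamma_op mu) <-> is_hankel_matrix (gamma_entry mu).
Proof.
split=> [[g Gg hg] n k n' k' nk|hg].
  by apply: (@complexI R); rewrite !(matrix_operator_inj Gg) (hg _ _ _ _ nk).
exists (fun n k => ((gamma_entry mu n k)%:C)%C) => // n k n' k' nk.
by rewrite (hg _ _ _ _ nk).
Qed.

Theorem theorem2p2 (R : realType)
    (mu : {finite_measure set (measurableTypeR R) -> \bar R})
    (mu01 : mu (~` `]0, 1[) = 0%E) :
  is_hankel_operator (Gamma_op mu) <->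
  exists c : R, forall A : set (measurableTypeR R), measurable A ->
    A `<=` `]0, 1[ -> mu A = (c%:E * @lebesgue_measure R A)%E.
Proof.
rewrite Gamma_hankelP; split=> [hank|[c muE] n k n' k' nk]; last first.
  by rewrite !(gamma_entry_scale c mu muE) nk.
have mu_fin : (mu `]0%R, 1%R[%classic < +oo)%E.
  by rewrite ltey_eq fin_num_measure.
pose c := fine (mu `]0%R, 1%R[%classic).
have c0 : 0 <= c by exact: fine_ge0.
pose nu : {measure set (measurableTypeR R) -> \bar R} :=
  mscale (NngNum c0) lebesgue_measure.
exists c => A mA A01.
apply: (moments_determine_measure mu nu) => // [|n].
  by rewrite /nu /= /mscale/= lebesgue_measure_itv/= lte01 EFinN sube0 mule1 ltry.
by rewrite moment_hankel// -gamma_entry_moment (gamma_entry_scale c).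
Qed.
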